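(* Let $n\ge t\ge 1$ be integers and $\Bbbk$ a field. For every integer $p$, $$\widetilde{H}_p(\Omega^n_t;\Bbbk)\cong\begin{cases}\widetilde{H}_{p+1-\frac{2n}{t+1}}(\{\emptyset\};\Bbbk) & \text{if } n\equiv 0 \pmod{t+1},\\ \widetilde{H}_{p+2-\frac{2(n+1)}{t+1}}(\{\emptyset\};\Bbbk) & \text{if } n\equiv t \pmod{t+1},\\ 0 & \text{otherwise.}\end{cases}$$
   Context: For integers $n\ge t\ge 1$, $\Omega^n_t$ is the simplicial complex on vertex set $\{1,\dots,n\}$ whose facets are the sets $\{1,\dots,n\}\setminus\{i,i+1,\dots,i+t-1\}$ for $i=1,\dots,n-t+1$ (so $\Omega^t_t=\{\emptyset\}$). $\widetilde{H}_p(\cdot;\Bbbk)$ denotes reduced simplicial homology over $\Bbbk$. The irrelevant complex $\{\emptyset\}$ has $\widetilde{H}_{-1}(\{\emptyset\};\Bbbk)\cong\Bbbk$ and $\widetilde{H}_p(\{\emptyset\};\Bbbk)=0$ for $p\neq -1$. *)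

(* Defs.v *)
From HB Require Import structures.
From mathcomp Require Import all_boot all_order all_algebra.
Set Implicit Arguments.
Unset Strict Implicit.
Unset Printing Implicit Defensive.
Import Order.TTheory GRing.Theory Num.Theory.

(* A simplicial complex on the (ordered) vertex set 'I_n is given by the
   predicate of its faces (a downward closed family of subsets). *)

Definition faces (n : nat) (D : pred {set 'I_n}) (s : nat) : seq {set 'I_n} :=
  enum [set σ : {set 'I_n} | D σ && (#|σ| == s)].

Definition nf (n : nat) (D : pred {set 'I_n}) (s : nat) : nat := size (faces D s).

(* Simplicial boundary map from (s-1)-chains (faces with s vertices) to
   (s-2)-chains, acting on row vectors, with the usual sign (-1)^k where k is
   the number of vertices of σ smaller than the removed vertex.  For s = 1 it
   is the augmentation to the empty face (reduced complex); for s = 0 it is 0. *)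
Definition bd (K : fieldType) (n : nat) (D : pred {set 'I_n}) (s : nat)
  : 'M[K]_(nf D s, nf D s.-1) :=
  \matrix_(i, j)
    let σ := nth set0 (faces D s) i in
    let τ := nth set0 (faces D s.-1) j in
    if (τ \subset σ) && (#|σ| == #|τ|.+1) then
      ((-1) ^+ #|[set x in σ | [exists v in σ :\: τ, (x < v)%N]]|)%R
    else 0%R.

(* Dimension over K of the reduced homology group  H~_p(D; K),
   computed as the rank of a complement of im ∂_{p+1} in ker ∂_p
   (chains of degree p are spanned by faces with p+1 vertices). *)
Definition dim_redH (K : fieldType) (n : nat) (D : pred {set 'I_n}) (p : int) : nat :=
  match (p + 1)%R with
  | Posz s => \rank (kermx (bd K D s) :\: bd K D s.+1)%MS
  | Negz _ => 0
  end.

(* Omega^n_t on vertices 0..n-1 (paper's vertex j is our j-1): faces are the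
   subsets of some facet  'I_n minus {i, ..., i+t-1},  0 <= i <= n-t. *)
Definition Omega (n t : nat) : pred {set 'I_n} :=
  fun σ => [exists i : 'I_n, (i + t <= n)%N &&
             [forall x in σ, (x < i)%N || (i + t <= x)%N]].

Definition irrelevant : pred {set 'I_0} := fun σ => σ == set0.
Arguments Omega n t : clear implicits.

(* Main.v *)
(* A sequence of element matchings (toggle v_0, then toggle v_1 on the faces left
   unmatched, and so on) is an acyclic discrete Morse matching.  Acyclicity makes
   the block of the boundary matrix on the matched pairs triangular, so its rank
   is at least the number of matched pairs; together with [bd *m bd = 0] this
   bounds each Betti number by the number of critical faces, with equality when
   all critical faces have the same size.  For Omega^n_t, whose faces are the
   sets missing t consecutive vertices, toggle the vertices v_j = j(t+1), counted
   from 0.  A face unmatched by v_0 has the characteristic word 0^t 1 w with no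
   further run of t zeros, and each later toggle forces one more block 1 0^(t-1) 1
   of length t+1.  Hence there is at most one critical face, and there is one
   exactly when the last block is complete or lacks only its final letter. *)
Require Import Defs.
From HB Require Import structures.
From mathcomp Require Import all_boot all_order all_algebra.
From mathcomp Require Import zify.
Import Order.TTheory GRing.Theory Num.Theory.

Set Implicit Arguments.
Unset Strict Implicit.

(** * Element matchings *)

Section Toggle.
Variable T : finType.
Implicit Types (v w x : T) (a b : {set T}) (R : pred {set T}) (vs : seq T).

Definition toggle v a : {set T} := if v \in a then a :\ v else v |: a.

Lemma in_toggle v a x : (x \in toggle v a) = (x == v) (+) (x \in a).
Proof.
rewrite /toggle; case: ifP => va; rewrite !inE; case: eqP => [->|_] //=.
  by rewrite va.
by rewrite va.
Qed.

Lemma toggleK v : involutive (toggle v).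
Proof. by move=> a; apply/setP=> x; rewrite !in_toggle addbA addbb. Qed.

Lemma card_toggle_mem v a : v \in a -> #|a| = #|toggle v a|.+1.
Proof. by move=> va; rewrite /toggle va (cardsD1 v a) va. Qed.

Lemma toggle_cover v a b : b \subset a -> #|a| = #|b|.+1 ->
  v \in a -> v \notin b -> a = toggle v b.
Proof.
move=> sba cab va vb; rewrite /toggle (negPf vb); apply/esym/eqP.
by rewrite eqEcard cab cardsU1 vb subUset sub1set va sba /=.
Qed.

Definition unmatched R v : pred {set T} :=
  fun a => R a && ~~ R (toggle v a).

Fixpoint pivot R vs a : option T :=
  if vs is v :: vs' then
    if R (toggle v a) then Some v else pivot (unmatched R v) vs' a
  else None.

Definition critical R vs : pred {set T} := foldl unmatched R vs.

Definition mate R vs a : {set T} :=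
  if pivot R vs a is Some v then toggle v a else a.

Definition upper R vs a : bool :=
  R a && (if pivot R vs a is Some v then v \in a else false).

(* A base-3 number, one digit per vertex of [vs].  A face [a] that survives to
   the round of [v] gets the digit 0 if it is unmatched and contains [v], 1 if
   it is matched, 2 if it is unmatched and avoids [v]; digits after the round
   in which [a] is matched are 0. *)
Fixpoint potential R vs a : nat :=
  if vs is v :: vs' then
    if R (toggle v a) then 3 ^ size vs'
    else 2 * (v \notin a) * 3 ^ size vs' + potential (unmatched R v) vs' a
  else 0.

Lemma criticalE R vs a : critical R vs a = R a && (pivot R vs a == None).
Proof.
rewrite /critical; elim: vs R => [|v vs IH] R /=; first by rewrite andbT.
rewrite IH /unmatched; case: (R a) => //=; by case: (R (toggle v a)).
Qed.

Lemma pivot_mem R vs a v : pivot R vs a = Some v -> v \in vs.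
Proof.
elim: vs R => //= w vs IH R; case: ifP => _ => [[->]|/IH]; rewrite inE ?eqxx //.
by move->; rewrite orbT.
Qed.

(** Every round before that of [v] leaves both [a] and [toggle v a] unmatched, so the two faces
    agree on their pivot and pairing is symmetric. *)
Lemma pivot_toggle R vs a v : R a -> pivot R vs a = Some v ->
  R (toggle v a) /\ pivot R vs (toggle v a) = Some v.
Proof.
elim: vs R => //= w vs IH R Ra; case: ifP => [Rw [<-]|Rw].
  by rewrite toggleK Ra.
case/IH; first by rewrite /unmatched Ra Rw.
by case/andP=> Rv /negPf Rwv pE; rewrite Rwv.
Qed.

Lemma mateP R vs a : R a -> R (mate R vs a).
Proof.
move=> Ra; rewrite /mate; case E: pivot => [v|] //.
by case: (pivot_toggle Ra E).
Qed.

Lemma mateK R vs a : R a -> mate R vs (mate R vs a) = a.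
Proof.
move=> Ra; rewrite {2}/mate; case E: (pivot R vs a) => [v|]; last first.
  by rewrite /mate E.
by case: (pivot_toggle Ra E) => _ E'; rewrite /mate E' toggleK.
Qed.

Lemma upper_mate R vs a : R a ->
  upper R vs (mate R vs a) = ~~ upper R vs a && ~~ critical R vs a.
Proof.
move=> Ra; rewrite criticalE /upper (mateP vs Ra) Ra /= /mate.
case E: (pivot R vs a) => [v|]; last by rewrite E.
by case: (pivot_toggle Ra E) => _ ->; rewrite in_toggle eqxx andbT.
Qed.

Lemma card_upper R vs a : upper R vs a -> #|a| = #|mate R vs a|.+1.
Proof.
rewrite /upper /mate => /andP[_]; case: pivot => // v; exact: card_toggle_mem.
Qed.

Lemma mate_sub R vs a : upper R vs a -> mate R vs a \subset a.
Proof.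
rewrite /upper /mate => /andP[_]; case: pivot => // v va.
by rewrite /toggle va subsetDl.
Qed.

(** Digits are at most 2, so a strict difference in the leading digit decides a comparison of
    potentials. *)
Lemma potential_lt R vs a : potential R vs a < 3 ^ size vs.
Proof.
elim: vs R => //= v vs IH R; have h := IH (unmatched R v).
have := expn_gt0 3 (size vs); rewrite expnS.
by case: ifP => _; first lia; case: (v \in a) => /=; lia.
Qed.

(* Acyclicity: the potential strictly decreases along gradient paths. *)
Lemma potential_decr R vs a a' : uniq vs -> upper R vs a -> upper R vs a' ->
  mate R vs a' \subset a -> #|a| = #|mate R vs a'|.+1 -> a != a' ->
  potential R vs a' < potential R vs a.
Proof.
elim: vs R => [|v vs IH] R; first by rewrite /upper /= andbF.
rewrite cons_uniq => /andP[vvs uvs].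
have pos := expn_gt0 3 (size vs).
rewrite {1 2}/upper /mate /=.
case: (boolP (R (toggle v a))) => Ra; case: (boolP (R (toggle v a'))) => Ra'.
(* Both matched in this round: each of [a] and [a'] is the mate of [a'] with [v] added, so they are
   equal. *)
- move=> /andP[_ va] /andP[_ va'] sub card; case/eqP.
  by rewrite (toggle_cover sub card va) ?toggleK // in_toggle eqxx va'.
(* Leading digit 1 against 0, unless [v] is missing from [a'] and hence from its mate. In that case
   toggling [v] in the mate yields the face [a], although the mate stayed unmatched in this
   round. *)
- move=> /andP[RA va] /andP[RA' ua'] sub card nE.
  have [va'|va'] := boolP (v \in a'); first by have := potential_lt (unmatched R v) vs a'; lia.
  have Ua' : unmatched R v a' by rewrite /unmatched RA'.
  have := mateP vs Ua'; rewrite /mate.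
  case E: (pivot _ _ _) ua' sub card => [w|] // wa' sub card.
  have wv : v != w by apply: contraNneq vvs => ->; exact: pivot_mem E.
  case/andP=> _; rewrite -(toggle_cover sub card va) ?RA //.
  by rewrite in_toggle (negPf wv).
(* Leading digit 2 against 1, since [v] in [a] would again force [a = a']. *)
- move=> /andP[RA ua] /andP[RA' va'] sub card nE.
  have va : v \notin a.
    apply: contra nE => va.
    by rewrite (toggle_cover sub card va) ?toggleK // in_toggle eqxx va'.
  by rewrite va /=; lia.
(* Both survive this round; the leading digits agree and induction compares the rest. *)
move=> /andP[RA ua] /andP[RA' ua'] sub card nE.
have Ua' : unmatched R v a' by rewrite /unmatched RA'.
have Ua : unmatched R v a by rewrite /unmatched RA.
have lt : potential (unmatched R v) vs a' < potential (unmatched R v) vs a.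
  by apply: IH => //; rewrite /upper ?Ua ?Ua'.
suff -> : (v \in a) = (v \in a') by rewrite ltn_add2l.
have := mateP vs Ua'; rewrite /mate.
case E: (pivot _ _ _) ua' sub card => [w|] // wa' sub card /andP[_ nR].
have wv : (v == w) = false.
  by apply: contraNF vvs => /eqP->; exact: pivot_mem E.
have vb : (v \in toggle w a') = (v \in a') by rewrite in_toggle wv.
rewrite -vb; apply/idP/idP => [va|]; last exact: (subsetP sub).
apply: contraNT nR => nvb; by rewrite -(toggle_cover sub card va).
Qed.

Definition matched_at R vs s : {set {set T}} :=
  [set a | upper R vs a & #|a| == s].

Definition critical_at R vs s : {set {set T}} :=
  [set a | critical R vs a & #|a| == s].

(** The faces of size [s] that are neither upper nor critical are the lower ends of pairs, and
    [mate] sends them bijectively to the upper faces of size [s.+1]. *)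
Lemma card_matching R vs s :
  #|[set a | R a & #|a| == s]|
  = #|matched_at R vs s| + #|matched_at R vs s.+1| + #|critical_at R vs s|.
Proof.
pose L := [set a | R a && ~~ upper R vs a && ~~ critical R vs a & #|a| == s].
have RL a : a \in L -> R a by rewrite inE => /andP[/andP[/andP[]]].
have cL : #|L| = #|matched_at R vs s.+1|.
  rewrite -(card_in_imset (f := mate R vs) (D := L)); last first.
    move=> a b /RL Ra /RL Rb E; by rewrite -(mateK vs Ra) E mateK.
  apply: eq_card => b; rewrite [in RHS]inE; apply/imsetP/andP.
  - case=> a aL ->; move: (aL); rewrite inE => /andP[/andP[/andP[Ra nu] nc] ca].
    have u : upper R vs (mate R vs a) by rewrite upper_mate // nu nc.
    by rewrite u (card_upper u) mateK // eqSS.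
  - case=> ub cb; have /andP[Rb _] := ub.
    have Rm := mateP vs Rb.
    exists (mate R vs b); last by rewrite mateK.
    rewrite inE Rm /= -upper_mate // mateK // ub /=.
    by rewrite -eqSS -card_upper.
rewrite -cL /matched_at /critical_at -!sum1dep_card /L.
rewrite (bigID (upper R vs)) /=; rewrite -addnA; congr (_ + _).
  by apply: eq_bigl => a; rewrite /upper; case: (R a); rewrite ?andbF //= andbC.
rewrite (bigID (critical R vs)) /= addnC; congr (_ + _).
  by apply: eq_bigl => a; rewrite -!andbA; do !bool_congr.
apply: eq_bigl => a; rewrite criticalE /upper.
case: (R a) => //=; case: pivot => [v|] //=; by rewrite ?andbF ?andbT.
Qed.

End Toggle.
(** * Ranks of the boundary maps *)

(** The coordinates of a vector in the left kernel of the selected rows vanish one by one, from the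
    largest [h] down: in column [g i] the other nonzero entries lie in rows with larger [h]. *)
Lemma leq_rank_triangular (K : fieldType) (m n r : nat) (A : 'M[K]_(m, n))
    (f : 'I_r -> 'I_m) (g : 'I_r -> 'I_n) (h : 'I_r -> nat) :
  (forall i, A (f i) (g i) != 0%R) ->
  (forall i j, A (f i) (g j) != 0%R -> i != j -> h j < h i) ->
  r <= \rank A.
Proof.
move=> diag tri; have sub : (rowsub f A <= A)%MS.
  by apply/row_subP => i; rewrite row_rowsub row_sub.
apply: leq_trans (mxrankS sub); rewrite leq_eqVlt eq_sym; apply/orP; left.
change (row_free (rowsub f A)); rewrite -kermx_eq0; apply/rowV0P => u /sub_kermxP uA.
pose M := \max_(j < r) h j; pose c i := M - h i.
suff u0 k : forall i, c i < k -> u 0%R i = 0%R.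
  by apply/rowP => i; rewrite mxE (u0 (c i).+1).
elim: k => // k IH i cik; apply/eqP.
have /matrixP/(_ 0%R (g i)) := uA; rewrite !mxE (bigD1 i) //= big1 => [|j ji].
  by rewrite addr0 mxE => /eqP; rewrite mulf_eq0 (negPf (diag i)) orbF.
rewrite mxE; have [->|/tri/(_ ji) hij] := eqVneq (A (f j) (g i)) 0%R; first by rewrite mulr0.
rewrite IH ?mul0r //; by have : h j <= M := leq_bigmax j; rewrite /c in cik *; lia.
Qed.

Section Boundary.
Variables (K : fieldType) (n : nat).
Implicit Types (D : pred {set 'I_n}) (s : nat).

Definition incidence (a b : {set 'I_n}) : K :=
  (if (b \subset a) && (#|a| == #|b|.+1) then
      (-1) ^+ #|[set x in a | [exists v in a :\: b, (x < v)%N]]|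
    else 0)%R.

Lemma bdE D s i j :
  bd K D s i j = incidence (nth set0 (faces D s) i) (nth set0 (faces D s.-1) j).
Proof. by rewrite mxE. Qed.

Lemma mem_faces D s a : (a \in faces D s) = D a && (#|a| == s).
Proof. by rewrite mem_enum inE. Qed.

Lemma nfE D s : nf D s = #|[set a | D a & #|a| == s]|.
Proof. by rewrite cardE. Qed.

Lemma incidence_neq0 a b : (incidence a b != 0)%R = (b \subset a) && (#|a| == #|b|.+1).
Proof. by rewrite /incidence; case: ifP => _; rewrite ?signr_eq0 ?eqxx. Qed.

Lemma incidenceU1 (v : 'I_n) (b : {set 'I_n}) : v \notin b ->
  incidence (v |: b) b = ((-1) ^+ #|[set x in b | (x < v)%N]|)%R.
Proof.
move=> vb; rewrite /incidence subsetUr cardsU1 vb eqxx /=; congr (_ ^+ _)%R.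
apply: eq_card => x; rewrite !inE; apply/andP/andP => [[xvb]|[xb xv]].
  case/existsP=> w; rewrite !inE => /andP[/andP[wb]]; rewrite (negPf wb) orbF => /eqP-> xw.
  by case/orP: xvb xw => [/eqP->|]; rewrite ?ltnn.
split; first by rewrite xb orbT.
by apply/existsP; exists v; rewrite !inE eqxx vb.
Qed.

Lemma incidence_neq0P (a b : {set 'I_n}) : (incidence a b != 0)%R ->
  exists2 v, v \notin b & a = v |: b.
Proof.
rewrite incidence_neq0 => /andP[sba /eqP cab].
have: 0 < #|a :\: b| by rewrite cardsD (setIidPr sba) cab subSnn.
case/card_gt0P=> v; rewrite inE => /andP[vb va]; exists v => //.
by rewrite (toggle_cover sba cab va vb) /toggle (negPf vb).
Qed.

Lemma card_ltU1 (b : {set 'I_n}) (v w : 'I_n) : w \notin b ->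
  #|[set x in w |: b | x < v]| = (w < v) + #|[set x in b | x < v]|.
Proof.
move=> wb; case: (ltnP w v) => wv.
  rewrite -[RHS]/(1 + _) (_ : [set _ in _ | _] = w |: [set x in b | x < v]).
    by rewrite cardsU1 inE (negPf wb).
  by apply/setP=> x; rewrite !inE; case: eqP => [->|].
apply: eq_card => x; rewrite !inE; case: eqP => [->|] //=.
by rewrite ltnNge wv (negPf wb).
Qed.

(** If some term is nonzero, then [a] is [c] with two vertices [v], [w] added, and exactly two terms
    survive, one for each order of removing them. Their sign exponents differ by one, because only
    one of [w < v] and [v < w] holds. *)
Lemma incidence_comp D s (a c : {set 'I_n}) :
  (forall x y : {set 'I_n}, x \subset y -> D y -> D x) ->
  D a -> (\sum_(b <- faces D s) incidence a b * incidence b c = 0)%R.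
Proof.
move=> Dd Da; rewrite big_enum /=.
have [[b bD]|] := altP (existsP (P := fun b => (b \in [set x | D x & #|x| == s])
   && (incidence a b * incidence b c != 0)%R)); last first.
  rewrite negb_exists => /forallP h; apply: big1 => b bD.
  by have := h b; rewrite bD negbK => /eqP.
case/andP: bD => bD; rewrite mulf_eq0 negb_or => /andP[/incidence_neq0P[v vb aE]].
case/incidence_neq0P=> w wc bE; subst b a.
move: vb; rewrite !inE negb_or => /andP[vw vc].
have wvc : w \notin v |: c by rewrite !inE negb_or eq_sym vw.
have vwc : v \notin w |: c by rewrite !inE negb_or vw.
move: (bD); rewrite inE cardsU1 wc => /andP[_ cs].
rewrite (bigD1 (w |: c)) //= (bigD1 (v |: c)) /=; last first.
  rewrite inE cardsU1 vc cs andbT; apply/andP; split.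
    by apply: Dd Da; rewrite setUS // subsetUr.
  by apply: contraNneq vwc => <-; rewrite setU11.
rewrite big1 ?addr0; last first.
  move=> b /andP[/andP[_ b1] b2]; apply/eqP/contraT; rewrite mulf_eq0 negb_or => /andP[].
  rewrite incidence_neq0 => /andP[sb _] /incidence_neq0P[x xc bE]; subst b.
  move/subsetP/(_ x): sb; rewrite !inE eqxx (negPf xc) !orbF => /(_ isT) /orP[] /eqP E.
    by rewrite E eqxx in b2.
  by rewrite E eqxx in b1.
rewrite !incidenceU1 // setUCA !incidenceU1 // !card_ltU1 // -!exprD.
have /orP[wv|wv] : (w < v) || (v < w).
  by rewrite -neq_ltn eq_sym.
- rewrite wv ltnNge (ltnW wv) /= add0n add1n addSn exprS addnC.
  by rewrite mulN1r addNr.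
- rewrite wv ltnNge (ltnW wv) /= add0n add1n addSn exprS addnC.
  by rewrite mulN1r subrr.
Qed.

Lemma bd_bd D s : (forall x y : {set 'I_n}, x \subset y -> D y -> D x) ->
  (bd K D s.+1 *m bd K D s = 0)%R.
Proof.
move=> Dd; apply/matrixP => i j; rewrite !mxE.
under eq_bigr => k _ do rewrite !bdE.
set a := nth _ _ i; set c := nth _ _ j.
rewrite -[RHS](incidence_comp s c Dd (a := a)); first by rewrite (big_nth set0) big_mkord.
have : a \in faces D s.+1 by apply: mem_nth.
by rewrite mem_faces => /andP[].
Qed.

Lemma dim_redHE D s : (forall x y : {set 'I_n}, x \subset y -> D y -> D x) ->
  dim_redH K D (Posz s - 1)%R + \rank (bd K D s) + \rank (bd K D s.+1) = nf D s.
Proof.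
move=> Dd; rewrite /dim_redH subrK.
have sub : (bd K D s.+1 <= kermx (bd K D s))%MS by apply/sub_kermxP/bd_bd.
have := mxrank_cap_compl (kermx (bd K D s)) (bd K D s.+1).
rewrite (capmx_idPr sub) mxrank_ker => E.
have := rank_leq_row (bd K D s); lia.
Qed.

(** Rows are the upper faces, columns their mates, and [potential] is the triangular order. *)
Lemma leq_matched_rank_bd D vs s : uniq vs ->
  #|matched_at D vs s| <= \rank (bd K D s).
Proof.
move=> uvs; case: s => [|s].
  rewrite [X in X <= _](_ : _ = 0) //; apply: eq_card0 => a; rewrite !inE.
  by apply/negP => /andP[/card_upper->].
pose a (i : 'I_#|matched_at D vs s.+1|) := enum_val i.
have au i : upper D vs (a i) by have := enum_valP i; rewrite inE => /andP[].
have ac i : #|a i| = s.+1 by have := enum_valP i; rewrite inE => /andP[_ /eqP].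
have Da i : D (a i) by have /andP[] := au i.
have aF i : a i \in faces D s.+1 by rewrite mem_faces Da ac /=.
have mF i : mate D vs (a i) \in faces D s.
  by rewrite mem_faces mateP //= -eqSS -card_upper // ac.
have lF s' b : b \in faces D s' -> index b (faces D s') < nf D s' by rewrite -index_mem.
apply: (@leq_rank_triangular _ _ _ _ _ (fun i => Ordinal (lF _ _ (aF i)))
          (fun i => Ordinal (lF _ _ (mF i))) (fun i => potential D vs (a i))).
  by move=> i; rewrite bdE /= !nth_index // incidence_neq0 mate_sub //=; apply/eqP; exact: card_upper.
move=> i j; rewrite bdE /= !nth_index // incidence_neq0 => /andP[sub /eqP card] ij.
apply: potential_decr => //; by rewrite (inj_eq enum_val_inj).
Qed.

End Boundary.

(** Rank-nullity and the count of the matching compute the number of faces of each size twice. Where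
    no face is critical, the bound of matched pairs by ranks must therefore be tight and homology
    vanishes; tightness in all sizes then gives the value at [s0]. *)
Lemma dim_redH_perfect (K : fieldType) n (D : pred {set 'I_n}) vs (s0 s : nat) :
  (forall x y : {set 'I_n}, x \subset y -> D y -> D x) -> uniq vs ->
  (forall a, critical D vs a -> #|a| = s0) ->
  dim_redH K D (Posz s - 1)%R = #|critical_at D vs s|.
Proof.
move=> Dd uvs c0.
pose r s := \rank (bd K D s); pose m s := #|matched_at D vs s|.
have mr k : m k <= r k by exact: leq_matched_rank_bd.
have E k : dim_redH K D (Posz k - 1)%R + r k + r k.+1 = m k + m k.+1 + #|critical_at D vs k|.
  by rewrite dim_redHE // nfE (card_matching D vs).
have c0k k : k != s0 -> #|critical_at D vs k| = 0.
  move=> ks; apply: eq_card0 => a; rewrite !inE; apply/negP=> /andP[/c0 ->].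
  by rewrite eq_sym (negPf ks).
have mrE k : m k = r k.
  case: k => [|k].
    (* Here [0.-1] is 0, so the matrix is square on the empty face; it is zero because the empty set
       covers nothing. *)
    apply/eqP; rewrite eqn_leq mr /= /r (_ : bd K D 0 = 0%R) ?mxrank0 //.
    apply/matrixP => i j; rewrite bdE mxE; apply/eqP; apply: contraT.
    rewrite incidence_neq0 => /andP[_].
    have : nth set0 (faces D 0) i \in faces D 0 by apply: mem_nth.
    by rewrite mem_faces => /andP[_ /eqP->].
  (* The rank in size [k.+1] occurs in the equations for [k] and for [k.+1], and at least one of
     these sizes differs from [s0]. *)
  have [ks|ks] := eqVneq k s0.
    have := E k.+1; rewrite c0k; last by lia.
    have := mr k.+1; have := mr k.+2; lia.
  have := E k; rewrite c0k //; have := mr k; have := mr k.+1; lia.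
have := E s; rewrite !mrE; lia.
Qed.

(** * The critical face of Omega *)

Section Words.
Variable t : nat.
Hypothesis t_gt0 : 0 < t.
Implicit Types (m : nat -> bool) (i j k x : nat).

(* The word of the critical face, of period 0 |-> 1, 1..t-1 |-> 0, t |-> 1 except
   that position 0 carries a 0. *)
Definition model x : bool :=
  (t <= x) && ((x %% t.+1 == 0) || (x %% t.+1 == t)).

(* The words of the faces left unmatched by the first [j] toggles (for [0 < j]):
   the first [j] blocks are forced, and no gap remains after them. *)
Definition survives j m : Prop :=
  (forall x, x < j * t.+1 -> m x = model x) /\
  (forall i, j * t.+1 <= i -> exists2 k, k < t & m (i + k)).

Definition has_gap m : Prop := exists i, forall k, k < t -> ~~ m (i + k).

Lemma model_block j x : x <= t ->
  model (j * t.+1 + x) = (0 < j) && (x == 0) || (x == t).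
Proof.
move=> xt; rewrite /model modnMDl modn_small //.
by case: j => [|j]; case: (ltngtP x t) xt => //=; case: x => //=; lia.
Qed.

Lemma gapPn m i : (forall k, k < t -> ~~ m (i + k)) \/ (exists2 k, k < t & m (i + k)).
Proof.
have [/hasP[k]|/hasPn h] := boolP (has (fun k => m (i + k)) (iota 0 t)).
  by rewrite mem_iota => kt mk; right; exists k.
by left=> k kt; apply: h; rewrite mem_iota.
Qed.

(** Windows starting after the toggled position [v] do not see it, so the toggle can only open a gap
    at [v] itself. This forces a 1 at [v] followed by zeros, and the window at [v.+1] then forces a
    1 at [v + t]. *)
Lemma survives_step m m' j : 0 < j ->
  (forall x, m' x = (x == j * t.+1) (+) m x) ->
  survives j m /\ ~ survives j m' <-> survives j.+1 m.
Proof.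
move=> j0 m'E; set v := j * t.+1 in m'E.
have m'v x : x != v -> m' x = m x by rewrite m'E => /negPf->.
have vS : j.+1 * t.+1 = v + t.+1 by rewrite mulSn addnC.
split=> [[[pre win] nS]|[pre win]].
  have nS' k : k < t -> ~ m' (v + k).
    move=> kt m'k; apply: nS; split=> [x xv|i].
      by rewrite m'v ?pre //; apply: contraTneq xv => ->; rewrite ltnn.
    rewrite leq_eqVlt => /predU1P[<-|vi]; first by exists k.
    by have [l lt ml] := win i (ltnW vi); exists l; rewrite // m'v //; rewrite -/v in vi; lia.
  have mv : m v by apply: contraT => nmv; case: (nS' 0 t_gt0); rewrite addn0 m'E eqxx; case: (m v) nmv.
  have m0 k : 0 < k < t -> m (v + k) = false.
    by case/andP=> k0 kt; apply: contraNF (introN idP (nS' k kt)) => mk; rewrite m'v //; lia.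
  have mt : m (v + t).
    have [|k kt mk] := win v.+1; first exact: leqnSn.
    have [E|kt'] := eqVneq k t.-1; first by rewrite E addSnnS prednK in mk.
    by rewrite addSnnS m0 // in mk; lia.
  split=> [x|i]; rewrite vS => h; last by apply: win; rewrite -/v; lia.
  have [xv|vx] := ltnP x v; first exact: pre.
  rewrite -(subnKC vx) model_block ?j0 /=; last by lia.
  move: (x - v) (subnKC vx) => y E.
  have [->|y0] := posnP y; first by rewrite addn0 mv.
  have [->|yt] := eqVneq y t; first by rewrite mt orbT.
  by rewrite m0 ?gtn_eqF //; lia.
rewrite vS in pre win.
have pre' y : y <= t -> m (v + y) = (y == 0) || (y == t).
  by move=> yt; rewrite pre ?model_block ?j0 //; lia.
have mv : m v by rewrite -[v]addn0 pre'.
split=> [|[_ win']].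
  split=> [x xv|i vi]; first by apply: pre; rewrite -/v in xv; lia.
  rewrite -/v in vi; have [it|ti] := leqP (v + t.+1) i; first exact: win.
  have [iv|iv] := eqVneq i v; first by exists 0; rewrite // addn0 iv.
  exists (v + t - i); first by lia.
  by rewrite (_ : i + _ = v + t) ?pre' ?eqxx ?orbT //; lia.
have [k kt] := win' v (leqnn _); rewrite m'E.
case: k kt => [|k] kt; first by rewrite addn0 eqxx mv.
by rewrite pre' 1?ltnW // (ltn_eqF kt) addbF gtn_eqF //; lia.
Qed.

(** A gap starting after position 0 would persist in [m'], so the only gap starts at 0, and the
    window at 1 forces a 1 at [t]. *)
Lemma survives_first m m' : (forall x, m' x = (x == 0) (+) m x) ->
  has_gap m /\ ~ has_gap m' <-> survives 1 m.
Proof.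
move=> m'E.
have m'v x : 0 < x -> m' x = m x by rewrite m'E; case: x.
split=> [[[i0 gap] nG]|[pre win]].
  have win i : 0 < i -> exists2 k, k < t & m (i + k).
    move=> i_gt0; have [g|] := gapPn m i; last by [].
    by case: nG; exists i => k kt; rewrite m'v ?g // addn_gt0 i_gt0.
  have i00 : i0 = 0.
    by case: (posnP i0) => // /win[k kt mk]; have := gap k kt; rewrite mk.
  subst i0.
  have mt : m t.
    have [|k kt mk] := win 1; first by [].
    have [E|kt'] := eqVneq k t.-1; first by rewrite E add1n prednK in mk.
    by have := gap k.+1; rewrite -[0 + _]/(1 + k) mk; lia.
  split=> [x|i]; rewrite mul1n => h; last by apply: win; lia.
  rewrite -[x]/(0 * t.+1 + x) model_block //=.
  have [->|xt] := eqVneq x t; first by rewrite mt.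
  by apply/negbTE/(gap x); lia.
rewrite mul1n in pre win.
have pre' y : y <= t -> m y = (y == t).
  by move=> yt; rewrite pre // -[y]/(0 * t.+1 + y) model_block.
split=> [|[i gap]].
  by exists 0 => k kt; rewrite pre' ?(ltn_eqF kt) // ltnW.
have [i0|i0] := posnP i.
  by have := gap 0 t_gt0; rewrite i0 m'E eqxx pre' ?(ltn_eqF t_gt0).
have [it|ti] := leqP i t.
  have := gap (t - i); rewrite subnKC // m'v // pre' // eqxx; lia.
by have [k kt] := win i ti; have := gap k kt; rewrite m'v ?addn_gt0 ?i0 // => /negPf->.
Qed.

(** The initial block contains a single 1, every later block two. *)
Lemma count_model j : count model (iota 0 (j.+1 * t.+1)) = j.*2.+1.
Proof.
have block i : count model (iota (i * t.+1) t.+1) = (0 < i) + 1.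
  rewrite -[X in iota X]addn0 iotaDl count_map.
  rewrite (eq_in_count (a2 := fun x => (0 < i) && (x == 0) || (x == t))); last first.
    by move=> x; rewrite mem_iota add0n ltnS => xt; exact: model_block.
  rewrite -[X in iota _ X]addn1 iotaD count_cat /= eqxx orbT addn0; congr (_ + _).
  rewrite -(prednK t_gt0) /= eqxx andbT orbF -[RHS]addn0; congr (nat_of_bool _ + _).
  apply/eqP; rewrite -leqn0 leqNgt -has_count; apply/hasPn => x.
  rewrite mem_iota => h; rewrite (_ : (x == 0) = false) ?andbF; last by lia.
  by apply/eqP; lia.
elim: j => [|j IH]; first by rewrite mul1n (block 0).
by rewrite mulSnr iotaD count_cat IH add0n block /= doubleS addn2.
Qed.

Lemma survives_final j n m : n <= j * t.+1 -> (forall x, n <= x -> m x) ->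
  survives j m <-> (forall x, x < j * t.+1 -> m x = model x).
Proof.
move=> nj sent; split=> [[] //|pre]; split=> // i ji.
by exists 0; rewrite // addn0 sent // (leq_trans nj).
Qed.

End Words.

(** * Faces of Omega as words, and its critical face *)

Section Omega.
Variables n t : nat.
Hypothesis t_gt0 : 0 < t.
Implicit Types (a b : {set 'I_n}) (v : 'I_n) (x : nat).

(* The positions beyond the last vertex are occupied, which makes every window
   of the word that leaves the vertex set nonempty. *)
Definition word a x : bool := if insub x is Some v then v \in a else true.

Lemma word_ord a v : word a v = (v \in a).
Proof. by rewrite /word valK. Qed.

Lemma word_geq a x : n <= x -> word a x.
Proof. by rewrite leqNgt /word => h; rewrite insubF // (negPf h). Qed.

Lemma word_toggle v a x : word (toggle v a) x = (x == v) (+) word a x.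
Proof.
rewrite /word; case: insubP => [w _ <-|]; first by rewrite in_toggle.
by rewrite -leqNgt; have := ltn_ord v; case: eqP => [->|_] //; lia.
Qed.

Lemma Omega_gap a : Omega n t a <-> has_gap t (word a).
Proof.
split=> [/existsP[i /andP[itn /forallP h]]|[i gap]].
  exists i => k kt; have ikn : i + k < n by lia.
  rewrite -[i + k]/(val (Ordinal ikn)) word_ord; apply/negP => ia.
  by have := h (Ordinal ikn); rewrite ia /=; lia.
have itn : i + t <= n.
  (* A window reaching past the vertex set ends on an occupied position, so it is not a gap. *)
  rewrite leqNgt; apply/negP=> h; have := gap t.-1; rewrite word_geq ?ltn_predL //; last by lia.
  by move/(_ t_gt0).
have i_n : i < n by lia.
apply/existsP; exists (Ordinal i_n); rewrite itn /=; apply/forallP => x; apply/implyP => xa.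
rewrite ltnNge [X in _ || X]leqNgt -negb_and; apply/negP => /andP[ix xit].
have := gap (x - i); rewrite subnKC ?word_ord ?xa //; lia.
Qed.

Lemma Omega_closed a b : a \subset b -> Omega n t b -> Omega n t a.
Proof.
move=> /subsetP sab /existsP[i /andP[itn /forallP h]]; apply/existsP; exists i.
rewrite itn; apply/forallP => x; apply/implyP => /sab xb.
by have := h x; rewrite xb.
Qed.

(** [pmap insub] drops the multiples of [t.+1] that are not vertices. *)
Definition toggle_order j : seq 'I_n := pmap insub [seq i * t.+1 | i <- iota 0 j].

Lemma toggle_order_uniq j : uniq (toggle_order j).
Proof.
apply: pmap_sub_uniq; rewrite map_inj_uniq ?iota_uniq // => x y /eqP.
by rewrite eqn_pmul2r // => /eqP.
Qed.

Lemma toggle_orderS j (jn : j * t.+1 < n) : toggle_order j.+1 = rcons (toggle_order j) (Ordinal jn).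
Proof.
by rewrite /toggle_order -[j.+1]addn1 iotaD map_cat pmap_cat /= add0n insubT cats1.
Qed.

Lemma critical_survives j a : j * t.+1 < n ->
  critical (Omega n t) (toggle_order j.+1) a <-> survives t j.+1 (word a).
Proof.
elim: j a => [|j IH] a jn; rewrite toggle_orderS /critical foldl_rcons /unmatched.
  have := survives_first t_gt0 (word_toggle (Ordinal jn) a).
  have := Omega_gap a; have := Omega_gap (toggle (Ordinal jn) a).
  rewrite /=; move=> e1 e2 <-; rewrite -e1 -e2; split=> [/andP[-> /negP]|[-> /negP->]] //.
have jn' : j * t.+1 < n by rewrite (leq_ltn_trans _ jn) // leq_mul2r leqnSn orbT.
rewrite -/(critical _ _).
have := survives_step t_gt0 (ltn0Sn j) (word_toggle (Ordinal jn) a).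
rewrite -IH // -IH // => <-; split=> [/andP[-> /negP]|[-> /negP->]] //.
Qed.

Definition critical_face : {set 'I_n} := [set x : 'I_n | model t x].

Lemma card_critical_face : #|critical_face| = count (model t) (iota 0 n).
Proof.
by rewrite cardsE -sum1_card -sum1_count -(big_mkord (model t) (fun=> 1)) /index_iota subn0.
Qed.

(** The last block starts inside the vertex set, and the occupied positions from [n] on must agree
    with [model]. Past its first position a block has a 1 only at offset [t], so at most that one
    position may be cut off. *)
Lemma criticalP j a : j * t.+1 < n <= j.+1 * t.+1 ->
  critical (Omega n t) (toggle_order j.+1) a <->
  a = critical_face /\ ((n < j.+1 * t.+1) ==> (n.+1 == j.+1 * t.+1)).
Proof.
case/andP=> jn nj; rewrite critical_survives //.
rewrite (survives_final t_gt0 nj); last by move=> x; exact: word_geq.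
split=> [h|[-> /implyP h] x xj].
  split=> [|]; last apply/implyP=> lt.
    by apply/setP => x; rewrite inE -h ?word_ord // (leq_trans _ nj).
  have := h n lt; rewrite word_geq //; have -> : n = j * t.+1 + (n - j * t.+1) by lia.
  rewrite mulSn in lt *; rewrite model_block //; last by lia.
  by rewrite (gtn_eqF (_ : 0 < n - _)) ?subn_gt0 // andbF /= => /esym/eqP; lia.
have [xn|nx] := ltnP x n; first by rewrite -[x]/(val (Ordinal xn)) word_ord inE.
rewrite word_geq //; have /eqP E := h (leq_ltn_trans nx xj).
have -> : x = j * t.+1 + t by rewrite mulSn in E xj; lia.
by rewrite model_block // eqxx orbT.
Qed.

Lemma dim_redH_Omega (K : fieldType) j s : j * t.+1 < n <= j.+1 * t.+1 ->
  dim_redH K (Omega n t) (Posz s - 1)%R =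
  (((n < j.+1 * t.+1) ==> (n.+1 == j.+1 * t.+1)) && (s == #|critical_face|)).
Proof.
move=> jn; rewrite (dim_redH_perfect K (vs := toggle_order j.+1) (s0 := #|critical_face|)).
- have [good|bad] := boolP (_ ==> _); last first.
    apply: eq_card0 => a; rewrite inE; apply/negP => /andP[/(criticalP _ jn)[_ h]] _.
    by rewrite h in bad.
  have cE a : critical (Omega n t) (toggle_order j.+1) a = (a == critical_face).
    by apply/idP/eqP => [/(criticalP _ jn)[]|E] //; apply/(criticalP _ jn).
  have [->|sc] := eqVneq s #|critical_face|.
    rewrite -[RHS](cards1 critical_face); apply: eq_card => a.
    by rewrite !inE cE; case: eqP => // ->; exact: eqxx.
  apply: eq_card0 => a; rewrite inE cE; apply/negP => /andP[/eqP-> /eqP E].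
  by rewrite E eqxx in sc.
- exact: Omega_closed.
- exact: toggle_order_uniq.
- by move=> a /(criticalP _ jn)[->].
Qed.
End Omega.

(** * The irrelevant complex and the case distinction on [n] modulo [t.+1] *)

Lemma dim_redH_neg (K : fieldType) n (D : pred {set 'I_n}) (p : int) :
  (p < -1)%R -> dim_redH K D p = 0.
Proof. by rewrite /dim_redH => p1; case E: (p + 1)%R => [s|] //; lia. Qed.

Lemma dim_redH_irrelevant (K : fieldType) (p : int) :
  dim_redH K irrelevant p = (p == -1)%R.
Proof.
have [p1|p1] := ltP p (-1)%R; first by rewrite dim_redH_neg //; lia.
have [s ->] : exists s : nat, p = (Posz s - 1)%R by exists `|(p + 1)%R|%N; lia.
(* With the empty matching every face is critical, and the only face is empty. *)
rewrite (dim_redH_perfect K (vs := [::]) (s0 := 0)) //; last 2 first.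
- by move=> x y; rewrite /irrelevant => sxy /eqP yE; move: sxy; rewrite yE subset0.
- by move=> a /eqP->; rewrite cards0.
have [->|s0] := eqVneq s 0.
  rewrite -[RHS](cards1 (set0 : {set 'I_0})); apply: eq_card => a; rewrite !inE /critical /= /irrelevant.
  by case: eqP => // ->; rewrite cards0.
rewrite [RHS](_ : _ = 0); last by lia.
apply: eq_card0 => a; rewrite inE /critical /= /irrelevant.
by apply/negP => /andP[/eqP->]; rewrite cards0 eq_sym (negPf s0).
Qed.

Theorem mainTheorem2 (K : fieldType) (n t : nat) (p : int) :
  (1 <= t)%N -> (t <= n)%N ->
  dim_redH K (Omega n t) p =
    (if n %% t.+1 == 0 then
       dim_redH K irrelevant (p + 1 - ((2 * n) %/ t.+1)%:Z)%R
     else if n %% t.+1 == t then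
       dim_redH K irrelevant (p + 2 - ((2 * n.+1) %/ t.+1)%:Z)%R
     else 0)%N.
Proof.
move=> t_gt0 le_tn; rewrite !dim_redH_irrelevant.
(* The predecessor makes [j * t.+1] the largest multiple strictly below [n], hence the last toggled
   vertex. *)
pose j := n.-1 %/ t.+1.
have jn : j * t.+1 < n <= j.+1 * t.+1.
  have := divn_eq n.-1 t.+1; have := ltn_pmod n.-1 (ltn0Sn t); rewrite mulSn -/j; lia.
have mod0 : (n %% t.+1 == 0) = (n == j.+1 * t.+1).
  apply/idP/eqP => [|->]; last by rewrite modnMl.
  rewrite {1}(_ : n = j * t.+1 + (n - j * t.+1)); last by lia.
  have [E|nE] := eqVneq (n - j * t.+1) t.+1; first by rewrite mulSn; lia.
  by rewrite mulSn in jn *; rewrite modnMDl modn_small; lia.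
have modt : (n %% t.+1 == t) = (n.+1 == j.+1 * t.+1).
  apply/eqP/eqP => E.
    have [q nE] : exists q, n = q * t.+1 + t by exists (n %/ t.+1); rewrite -[X in _ + X]E -divn_eq.
    have -> : j = q by rewrite /j nE (_ : _.-1 = q * t.+1 + t.-1) ?divnMDl ?divn_small ?addn0 //; lia.
    by rewrite mulSn; lia.
  rewrite mulSn in E; rewrite (_ : n = j * t.+1 + t); last by lia.
  by rewrite modnMDl modn_small.
have quot m : m = j.+1 * t.+1 -> (2 * m) %/ t.+1 = j.+1.*2.
  by move=> ->; rewrite mulnA mulnK // mul2n.
rewrite mod0 modt.
have [p1|p1] := ltP p (-1)%R.
  rewrite dim_redH_neg //; case: eqP => [/quot ->|_]; first by lia.
  by case: eqP => [/quot->|_]; lia.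
have [s ->] : exists s : nat, p = (Posz s - 1)%R by exists `|(p + 1)%R|%N; lia.
rewrite (dim_redH_Omega t_gt0 K s jn) card_critical_face.
have [E|nE] := eqVneq n (j.+1 * t.+1).
  by rewrite (quot _ E) [in iota _ _]E count_model // {1}E ltnn /=; lia.
rewrite ltn_neqAle nE; case/andP: jn => _ -> /=.
have [E|//] := eqVneq n.+1 (j.+1 * t.+1); rewrite (quot _ E) /=.
(* The blocks cover one position more than the vertex set, and [model] is 1 there, so the critical
   face has [j.*2] vertices instead of [j.*2.+1]. *)
have := count_model t_gt0 j; rewrite -E -addn1 iotaD count_cat /= add0n.
have -> : model t n by rewrite /model le_tn modt E eqxx orbT.
lia.
Qed.
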